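(* Let $n\ge1$ be an integer, $\alpha,\beta>-1$, $a=\alpha+\beta$, $b=\alpha-\beta$, $c_n\neq0$ a constant, and $$\tau_n(x)=c_n\int_{[-1,1]^n}\Delta_n(z)^2\prod_{k=1}^n e^{xz_k}(1-z_k)^\alpha(1+z_k)^\beta\,dz_k .$$ Then $H(x)=H_n(x)=x\frac{d}{dx}\log\tau_n(x)$ satisfies $$x^2H'''+xH''+6x(H')^2-\big(4H+4x^2-4bx+(2n+a)^2\big)H'+(4x-2b)H+2n(n+a)x-bn(2n+a)=0,$$ with $H(0)=0$ and $H'(0)=\frac{-nb}{a+2n}$.
   Context: $\Delta_n(z)=\prod_{1\le i<j\le n}(z_j-z_i)$ is the Vandermonde determinant. *)

(* Defs.v *)
From HB Require Import structures.
From mathcomp Require Import all_boot all_order all_algebra.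
From mathcomp Require Import all_classical all_reals all_analysis.
Set Implicit Arguments. Unset Strict Implicit. Unset Printing Implicit Defensive.
Import Order.TTheory GRing.Theory Num.Theory.
Local Open Scope classical_set_scope.
Local Open Scope ring_scope.

Section Defs.
Variable R : realType.

Definition vandermonde (n : nat) (z : seq R) : R :=
  \prod_(i < n) \prod_(j < n | (i < j)%N) (z`_j - z`_i).

Fixpoint cube_int (n : nat) (F : seq R -> R) : R :=
  match n with
  | 0 => F [::]
  | m.+1 => \int[@lebesgue_measure R]_(t in `[-1, 1]) cube_int m (fun s => F (t :: s))
  end.

Definition jweight (alpha beta x z : R) : R :=
  expR (x * z) * (1 - z) `^ alpha * (1 + z) `^ beta.

Definition tau (n : nat) (alpha beta c : R) (x : R) : R :=
  c * cube_int n (fun z => vandermonde n z ^+ 2 *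
                           \prod_(k < n) jweight alpha beta x z`_k).

(* H(x) = x * d/dx log tau(x) = x * tau'(x) / tau(x). *)
Definition Hfun (n : nat) (alpha beta c : R) (x : R) : R :=
  x * (derive1 (tau n alpha beta c) x / tau n alpha beta c x).

End Defs.

(* Main.v *)
Require Import Defs.
From HB Require Import structures.
From mathcomp Require Import all_boot all_order all_algebra.
From mathcomp Require Import all_classical all_reals all_analysis.
From mathcomp Require Import perm measurable_realfun zify ring lra.
Set Implicit Arguments. Unset Strict Implicit. Unset Printing Implicit Defensive.
Import Order.TTheory GRing.Theory Num.Theory.
Import numFieldNormedType.Exports.
Local Open Scope ring_scope.

(** By Heine's formula tau is, up to a nonzero constant, the determinant of the
Hankel matrix G = (m_(i+j)) of the moments m_k(x) of the weight
e^(xz) (1-z)^alpha (1+z)^beta; G is invertible because its quadratic form is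
the integral of the square of a polynomial against a positive weight.

The coordinates of z^(n+l) on 1, z, ..., z^(n-1) modulo the kernel of the
moment pairing (the columns G^-1 u_l with (u_l)_i = m_(i+n+l)) are closed under
d/dx, since m_k' = m_(k+1), and (log det G)' is the first of them. In these
coordinates the KP equation
  h''' + 6 h'^2 + 3 d_2 q_2 - 4 q_3' = 0,   h = (log tau)',
is a polynomial identity, where q_k is the average of the power sum of degree k
and d_2 the derivation of the flow of z^2. Integration by parts gives a linear
recurrence for the moments; its traces against G^-1 are the Virasoro
constraints, which express x q_2, x q_3 and x d_2 q_2 through h, and eliminating
q_2 and q_3 from the KP equation yields the differential equation. *)

(** * Hankel matrices and Virasoro constraints *)

Section HankelAlgebra.
Variables (F : fieldType) (n : nat) (m : nat -> F).

Definition hankel (k : nat) : 'M[F]_n := \matrix_(i, j) m (i + j + k).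

Definition hankel_col (l : nat) : 'cV[F]_n := \col_i m (i + (n + l)).

(* The coefficient of z^(n-1-r) in the expansion of z^(n+l), with value 0 for
   r >= n: this convention makes the formulas below uniform in n. *)
Definition hankel_coord (r l : nat) : F :=
  \sum_(i < n | (i + r.+1 == n)%N) (invmx (hankel 0) *m hankel_col l) i 0.

Local Notation Y := hankel_coord.
Local Notation G := (hankel 0).

(** Column [j] holds the coordinates of [z^(j+k)]: this is multiplication by [z^k] followed by
    projection to degree below [n]. In general it is not the [k]-th power of [hankel_shift 1]. *)
Definition hankel_shift (k : nat) : 'M[F]_n := invmx G *m hankel k.
Local Notation Z := hankel_shift.

Lemma hankel_coord_ge r l : (n <= r)%N -> Y r l = 0.
Proof.
move=> nr; rewrite /hankel_coord big1// => i /eqP E.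
by move: E nr; lia.
Qed.

Lemma hankel_coordE (r : 'I_n) l :
  Y r l = (invmx G *m hankel_col l) (rev_ord r) 0.
Proof.
rewrite /hankel_coord (big_pred1 (rev_ord r))// => i /=.
rewrite -val_eqE /=; have rn := ltn_ord r.
by apply/eqP/eqP; lia.
Qed.

Lemma trmx_hankel k : (hankel k)^T = hankel k.
Proof. by apply/matrixP => i j; rewrite !mxE (addnC i). Qed.

Hypothesis Gu : G \in unitmx.

(** Reversed column [s] stands for [z^(n-1-s)]. Multiplied by [z^k] it has degree [n + (k-1-s)] when
    [s < k] and must be reduced to its coordinates; otherwise it is still a basis monomial. *)
Lemma hankel_shift_rev k (r s : 'I_n) :
  Z k (rev_ord r) (rev_ord s) =
    (if (s < k)%N then Y r (k.-1 - s) else 0) + (s == (r + k)%N :> nat)%:R.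
Proof.
have rn := ltn_ord r; have sn := ltn_ord s.
case: ltnP => [sk|ks].
  have -> : (s == (r + k)%N :> nat) = false.
    by apply/negbTE; rewrite neq_ltn (leq_trans sk)// leq_addl.
  rewrite addr0 hankel_coordE !mxE; apply: eq_bigr => i _.
  rewrite !mxE; congr (_ * m _) => /=.
  by lia.
rewrite add0r.
have rks : (n - s.+1 + k < n)%N by lia.
transitivity ((invmx G *m G) (rev_ord r) (Ordinal rks)).
  rewrite !mxE; apply: eq_bigr => i _.
  by rewrite !mxE /= addn0 addnA.
rewrite mulVmx// mxE -val_eqE /=; congr (_%:R).
by congr nat_of_bool; apply/eqP/eqP; lia.
Qed.


Lemma trace_rev (A : 'M[F]_n) : \tr A = \sum_(r < n) A (rev_ord r) (rev_ord r).
Proof. by rewrite /mxtrace (reindex_inj rev_ord_inj). Qed.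

(** This makes the trace formulas uniform in [n]: coordinates of index [r >= n] vanish, so
    truncating at [k] is harmless on either side of [n]. *)
Lemma sum_ord_tail k (f : nat -> F) :
  (forall r, (n <= r)%N -> f r = 0) -> (forall r, (k <= r)%N -> f r = 0) ->
  \sum_(r < n) f r = \sum_(r < k) f r.
Proof.
move=> fn fk; rewrite -!(big_mkord xpredT).
case: (leqP n k) => [nk|/ltnW kn].
  rewrite [RHS](big_cat_nat (leq0n n) nk)//= [X in _ = _ + X]big_nat.
  rewrite [X in _ = _ + X]big1 ?addr0// => r.
  by case/andP => /fn.
rewrite (big_cat_nat (leq0n k) kn)//= [X in _ + X]big_nat.
rewrite [X in _ + X]big1 ?addr0// => r.
by case/andP => /fk.
Qed.

Lemma sum_ord_pick k (f : nat -> F) (r : nat) :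
  \sum_(s < k) (s == r :> nat)%:R * f s = if (r < k)%N then f r else 0.
Proof.
case: ltnP => rk.
  rewrite (bigD1 (Ordinal rk))//= eqxx mul1r big1 ?addr0// => s.
  by rewrite -val_eqE /= => /negbTE->; rewrite mul0r.
rewrite big1// => s _; have := ltn_ord s.
by case: eqP => [->|]; rewrite ?mul0r// ltnNge rk.
Qed.

Definition rev_diag (d : nat -> F) : 'M[F]_n :=
  diag_mx (\row_i d (rev_ord i)).

(** The part of [hankel_shift k] contributed by the columns whose degree reaches [n]. *)
Let low k r s : F := if (s < k)%N then Y r (k.-1 - s) else 0.

Let low_ge k r s : (n <= r)%N -> low k r s = 0.
Proof. by move=> nr; rewrite /low; case: ifP => // _; exact: hankel_coord_ge. Qed.

Let low_ge2 k r s : (k <= s)%N -> low k r s = 0.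
Proof. by rewrite /low ltnNge => ->. Qed.

(** The pure shift part of [Z k.+1] lies off the diagonal, so only the first [k+1] reversed columns
    contribute. *)
Lemma trace_shift_diag k (d : nat -> F) :
  \tr (Z k.+1 *m rev_diag d) = \sum_(r < k.+1) d r * Y r (k - r).
Proof.
rewrite trace_rev.
transitivity (\sum_(r < n) (d r * low k.+1 r r)).
  apply: eq_bigr => r _; rewrite mul_mx_diag mxE hankel_shift_rev mxE rev_ordK.
  by rewrite -[X in X == _]addn0 eqn_add2l/= addr0 mulrC.
rewrite (@sum_ord_tail k.+1 (fun r => d r * low k.+1 r r)) => [|r|r].
- by apply: eq_bigr => r _; rewrite /low ltn_ord.
- by move/low_ge ->; rewrite mulr0.
- by move/low_ge2 ->; rewrite mulr0.
Qed.

(** Each factor is [low] plus a pure shift; the three sums are the low-low, low-shift and shift-low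
    products. *)
Lemma trace_shift_diag_shift j k (d : nat -> F) :
  \tr (Z j.+1 *m rev_diag d *m Z k.+1) =
    \sum_(r < k.+1) \sum_(s < j.+1) Y r (j - s) * d s * Y s (k - r)
    + \sum_(s < j.+1) Y (s + k.+1) (j - s) * d s
    + \sum_(r < k.+1) d (r + j.+1)%N * Y (r + j.+1) (k - r).
Proof.
rewrite trace_rev.
transitivity (\sum_(r < n) \sum_(s < n)
   (low j.+1 r s + (s == (r + j.+1)%N :> nat)%:R) * d s *
   (low k.+1 s r + (r == (s + k.+1)%N :> nat)%:R)).
  apply: eq_bigr => r _; rewrite mxE (reindex_inj rev_ord_inj)/=.
  apply: eq_bigr => s _; rewrite mul_mx_diag mxE !hankel_shift_rev.
  by rewrite mxE rev_ordK.
transitivity (\sum_(r < n) \sum_(s < n)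
   (low j.+1 r s * d s * low k.+1 s r
    + (r == (s + k.+1)%N :> nat)%:R * (low j.+1 r s * d s)
    + (s == (r + j.+1)%N :> nat)%:R * (d s * low k.+1 s r))).
  apply: eq_bigr => r _; apply: eq_bigr => s _.
  rewrite mulrDr !mulrDl.
  (* Both shifts raise the degree strictly, so the shift-shift product has no diagonal entry. *)
  have -> : (s == (r + j.+1)%N :> nat)%:R * d s * (r == (s + k.+1)%N :> nat)%:R = 0.
    case: eqP => [E|]; rewrite ?mul0r//; case: eqP => [E'|]; rewrite ?mulr0//.
    by move: E E'; lia.
  by rewrite addr0; ring.
under eq_bigr do rewrite !big_split/=.
rewrite !big_split/=; congr (_ + _ + _).
- pose f r := \sum_(s < n) low j.+1 r s * d s * low k.+1 s r.
  rewrite (@sum_ord_tail k.+1 f) /f => [|r rn|r rk].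
  + apply: eq_bigr => r _.
    rewrite (@sum_ord_tail j.+1 (fun s => low j.+1 r s * d s * low k.+1 s r)) => [|s|s].
    * by apply: eq_bigr => s _; rewrite /low !ltn_ord.
    * by move/low_ge ->; rewrite mulr0.
    * by move/low_ge2 ->; rewrite !mul0r.
  + by apply: big1 => s _; rewrite low_ge// !mul0r.
  + by apply: big1 => s _; rewrite (low_ge2 _ rk) !mulr0.
- rewrite exchange_big/=.
  pose f s := low j.+1 (s + k.+1) s * d s.
  transitivity (\sum_(s < n) f s).
    apply: eq_bigr => s _.
    rewrite (@sum_ord_pick n (fun r => low j.+1 r s * d s)) /f.
    by case: ltnP => // ?; rewrite low_ge// mul0r.
  rewrite (@sum_ord_tail j.+1) /f => [|r rn|r rk].
  + by apply: eq_bigr => s _; rewrite /low ltn_ord.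
  + by rewrite low_ge ?mul0r//; lia.
  + by rewrite low_ge2 ?mul0r.
- pose f r := d (r + j.+1)%N * low k.+1 (r + j.+1) r.
  transitivity (\sum_(r < n) f r).
    apply: eq_bigr => r _.
    rewrite (@sum_ord_pick n (fun s => d s * low k.+1 s r)) /f.
    by case: ltnP => // ?; rewrite low_ge// mulr0.
  rewrite (@sum_ord_tail k.+1) /f => [|r rn|r rk].
  + by apply: eq_bigr => s _; rewrite /low ltn_ord.
  + by rewrite low_ge ?mulr0//; lia.
  + by rewrite low_ge2 ?mulr0.
Qed.

Lemma shift_col_rev k (x : nat -> F) (r : 'I_n) :
  (forall s, (n <= s)%N -> x s = 0) ->
  (Z k.+1 *m \col_i x (rev_ord i)) (rev_ord r) 0 =
    \sum_(s < k.+1) Y r (k - s) * x s + x (r + k.+1)%N.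
Proof.
move=> xn; rewrite mxE (reindex_inj rev_ord_inj).
transitivity (\sum_(s < n) (low k.+1 r s * x s + (s == (r + k.+1)%N :> nat)%:R * x s)).
  by apply: eq_bigr => s _; rewrite hankel_shift_rev mxE rev_ordK mulrDl.
rewrite big_split/= (@sum_ord_pick n x); congr (_ + _); last first.
  by case: ltnP => // /xn ->.
rewrite (@sum_ord_tail k.+1 (fun s => low k.+1 r s * x s)) => [|s|s].
- by apply: eq_bigr => s _; rewrite /low ltn_ord.
- by move/xn ->; rewrite mulr0.
- by move/low_ge2 ->; rewrite mul0r.
Qed.


Lemma trace_shift k : \tr (Z k.+1) = \sum_(r < k.+1) Y r (k - r).
Proof.
rewrite -[Z _]mulmx1; have -> : 1%:M = rev_diag (fun=> 1).
  by rewrite -diag_const_mx; congr diag_mx; apply/rowP => i; rewrite !mxE.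
by rewrite trace_shift_diag; apply: eq_bigr => r _; rewrite mul1r.
Qed.

Lemma trace_shift_shift j k :
  \tr (Z j.+1 *m Z k.+1) =
    \sum_(r < k.+1) \sum_(s < j.+1) Y r (j - s) * Y s (k - r)
    + \sum_(s < j.+1) Y (s + k.+1) (j - s)
    + \sum_(r < k.+1) Y (r + j.+1) (k - r).
Proof.
rewrite -[Z j.+1]mulmx1; have -> : 1%:M = rev_diag (fun=> 1).
  by rewrite -diag_const_mx; congr diag_mx; apply/rowP => i; rewrite !mxE.
rewrite trace_shift_diag_shift; congr (_ + _ + _).
- by apply: eq_bigr => r _; apply: eq_bigr => s _; rewrite mulr1.
- by apply: eq_bigr => s _; rewrite mulr1.
- by apply: eq_bigr => r _; rewrite mul1r.
Qed.

(** In the basis [1, ..., z^(n-1)], [degmx] is the Euler operator [z d/dz] and [dermx] is [d/dz]. *)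
Let degmx : 'M[F]_n := rev_diag (fun r => n%:R - 1 - r%:R).
Let dermx : 'M[F]_n := \matrix_(i, j) (if i.+1 == j then j%:R else 0).

Let degmxE i j : degmx i j = (i == j)%:R * i%:R.
Proof.
rewrite !mxE mulr_natl; have -> // : n%:R - 1 - (rev_ord i)%:R = i%:R :> F.
by rewrite /= natrB// -addn1 natrD; ring.
Qed.

Let deg_mul (A : 'M[F]_n) i j : (degmx *m A) i j = i%:R * A i j.
Proof.
rewrite mxE (bigD1 i)//= degmxE eqxx mul1r big1 ?addr0// => k /negbTE.
by rewrite degmxE eq_sym => ->; rewrite !mul0r.
Qed.

Let mul_deg (A : 'M[F]_n) i j : (A *m degmx) i j = j%:R * A i j.
Proof.
rewrite mxE (bigD1 j)//= degmxE eqxx mul1r mulrC big1 ?addr0// => k /negbTE.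
by rewrite degmxE => ->; rewrite mul0r mulr0.
Qed.

Let mul_der i j : (G *m dermx) i j = j%:R * m (i + j).-1.
Proof.
rewrite mxE; have jn := ltn_ord j; case: (posnP j) => j0.
  by rewrite j0 mul0r big1// => k _; rewrite !mxE j0 mulr0.
have pn : (j.-1 < n)%N by lia.
rewrite (bigD1 (Ordinal pn))//= !mxE/= prednK// eqxx mulrC big1 ?addr0.
  by congr (_ * m _); lia.
move=> k; rewrite -val_eqE !mxE/= => /eqP kj.
by case: eqP => [E|]; rewrite ?mulr0//; move: kj E; lia.
Qed.

Let der_mul i j : (dermx^T *m G) i j = i%:R * m (i + j).-1.
Proof.
rewrite -[G]trmx_hankel -trmx_mul mxE mul_der.
by rewrite addnC.
Qed.

(** The product sends [z^j] to [j z^(j+1)], which has a coordinate on [z^j] only when [j = n-1],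
    where [z^n] is reduced. *)
Let trace_shift_der : \tr (Z 2 *m dermx) = (n%:R - 1) * Y 0 0.
Proof.
rewrite trace_rev.
transitivity (\sum_(r < n) (if (nat_of_ord r == 0)%N then (n%:R - 1) * Y 0 0 else 0)).
  apply: eq_bigr => r _; rewrite mxE (reindex_inj rev_ord_inj).
  case: (ltnP r.+1 n) => rn.
    rewrite (bigD1 (Ordinal rn))// big1 ?addr0 => [|s].
      rewrite hankel_shift_rev mxE /=.
      have -> : ((n - r.+2).+1 == n - r.+1)%N by lia.
      have -> : (r.+1 == r + 2)%N = false by lia.
      case: (nat_of_ord r) rn => [|r'] rn /=; last by rewrite !addr0 mul0r.
      by rewrite !addr0 subnn mulrC natrB//; lia.
    rewrite -val_eqE /= => sr; rewrite !mxE/=.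
    case: eqP; rewrite ?mulr0// => E; have := ltn_ord s; have := ltn_ord r.
    by move: sr E; lia.
  have rE : (rev_ord r : nat) = 0%N by rewrite /=; lia.
  rewrite big1 => [|s _]; last by rewrite !mxE rE mulr0.
  case: eqP => // r0; have -> : n = 1%N by have := ltn_ord r; lia.
  by rewrite subrr mul0r.
case: (posnP n) => [n0|n0].
  rewrite hankel_coord_ge ?n0// mulr0 big1// => r _.
  by rewrite if_same.
rewrite (bigD1 (Ordinal n0))//= big1 ?addr0// => r.
by rewrite -val_eqE/= => /negbTE ->.
Qed.

(** * Virasoro constraints as traces of the moment recurrence *)

Section Virasoro.
Variables a b x : F.
(** For Jacobi moments this is the vanishing integral of the derivative of [z^k e^(xz)
    (1-z)^(alpha+1) (1+z)^(beta+1)]. At [k = 0] the factor [k%:R] cancels the default value of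
    [m k.-1]. *)
Hypothesis mrec : forall k,
  k%:R * m k.-1 - (k%:R + 2 + a) * m k.+1 + x * (m k - m k.+2) - b * m k = 0.

Let trace_deg_shift k : \tr (invmx G *m (degmx *m hankel k)) = \tr (Z k *m degmx).
Proof.
rewrite -mxtrace_tr !trmx_mul trmx_inv !trmx_hankel tr_diag_mx.
by rewrite mxtrace_mulC mulmxA.
Qed.


Let degmx_mulE k : degmx *m hankel k = \matrix_(i, j) (i%:R * m (i + j + k)).
Proof. by apply/matrixP => i j; rewrite deg_mul !mxE. Qed.

Let mul_degmxE k : hankel k *m degmx = \matrix_(i, j) (j%:R * m (i + j + k)).
Proof. by apply/matrixP => i j; rewrite mul_deg !mxE. Qed.

Let mul_dermxE : G *m dermx = \matrix_(i, j) (j%:R * m (i + j).-1).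
Proof. by apply/matrixP => i j; rewrite mul_der !mxE. Qed.

Let dermx_mulE : dermx^T *m G = \matrix_(i, j) (i%:R * m (i + j).-1).
Proof. by apply/matrixP => i j; rewrite der_mul !mxE. Qed.

(** Entry [(i, j)] is the recurrence at index [i + j], whose factor [i + j] splits into a left and a
    right multiplication. The moment of index [i + j - 1] belongs to no [hankel k], hence the use of
    [dermx]. *)
Let mxrec0 : dermx^T *m G + G *m dermx - degmx *m hankel 1 - hankel 1 *m degmx
   - (2 + a) *: hankel 1 + (x - b) *: G - x *: hankel 2 = 0.
Proof.
rewrite degmx_mulE mul_degmxE mul_dermxE dermx_mulE.
apply/matrixP => i j; rewrite !mxE -[RHS](mrec (i + j)).
by rewrite addn0 addn1 addn2 natrD; ring.
Qed.

Let mxrecS k : degmx *m hankel k + hankel k *m degmx + k.+1%:R *: hankel k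
   - degmx *m hankel k.+2 - hankel k.+2 *m degmx - (k%:R + 3 + a) *: hankel k.+2
   + (x - b) *: hankel k.+1 - x *: hankel k.+3 = 0.
Proof.
rewrite !degmx_mulE !mul_degmxE.
apply/matrixP => i j; rewrite !mxE -[RHS](mrec (i + j + k.+1)).
rewrite !addnS/= -(addn1 (i + j + k)) -(addn1 k) !natrD; ring.
Qed.

(** Trace of [mxrec0] against [invmx G]. The derivative terms drop out because [dermx] has zero
    diagonal, and [Y 0 1 + Y 1 0] is the trace of [Z 2], that is [q_2]. *)
Lemma virasoro0 :
  x * (Y 0 1 + Y 1 0) = n%:R * (x - b) - (2 * n%:R + a) * Y 0 0.
Proof.
have /(congr1 (fun A => \tr (invmx G *m A))) := mxrec0.
rewrite mulmx0 mxtrace0 !mulmxDr !mulmxN !raddfD/= !raddfN/= -!scalemxAr !mxtraceZ.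
rewrite trace_deg_shift !mulmxA mulVmx// mul1mx mxtrace1.
rewrite mxtrace_mulC mulmxA mulmxV// mul1mx mxtrace_tr.
have -> : \tr dermx = 0.
  by apply: big1 => i _; rewrite mxE; case: eqP => // E; move: E; lia.
rewrite -!/(Z _) trace_shift_diag !trace_shift.
rewrite !big_ord_recl !big_ord0 /= !subn0 subnn => E.
apply/eqP; rewrite -subr_eq0 -oppr_eq0; apply/eqP; rewrite -[RHS]E; ring.
Qed.

(** Trace of the recurrence one index higher; the left factor of [x] is the trace of [Z 3], that is
    [q_3]. *)
Lemma virasoro1 :
  x * (Y 0 2 + Y 1 1 + Y 2 0) = n%:R ^+ 2 - (2 * n%:R + a) * (Y 0 1 + Y 1 0)
    - (Y 0 1 - Y 1 0) + (x - b) * Y 0 0.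
Proof.
have /(congr1 (fun A => \tr (invmx G *m A))) := mxrecS 0.
rewrite mulmx0 mxtrace0 !mulmxDr !mulmxN !raddfD/= !raddfN/= -!scalemxAr !mxtraceZ.
rewrite !trace_deg_shift !mulmxA -!/(Z _).
have -> : Z 0 = 1%:M by rewrite /Z mulVmx.
rewrite mul1mx mxtrace1.
have sum2 k : (\sum_(0 <= i < k) i%:R) * 2 = k%:R * (k%:R - 1) :> F.
  elim: k => [|k IH]; first by rewrite big_geq// !mul0r.
  by rewrite big_nat_recr//= mulrDl IH -natr1; ring.
(* Together with the trace [n] of [Z 0] this produces the term [n^2]. *)
have trD : \tr degmx + \tr degmx = n%:R * (n%:R - 1).
  transitivity ((\sum_(i < n) (i : nat)%:R) * 2 :> F).
    rewrite mulr2n mulrDr mulr1; congr (_ + _); apply: eq_bigr => i _;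
    by rewrite degmxE eqxx mul1r.
  rewrite -(big_mkord xpredT (fun i => i%:R)).
  exact: sum2.
rewrite !trace_shift_diag !trace_shift.
rewrite !big_ord_recl !big_ord0 /= /bump /= !subn0 subnn trD => E.
apply/eqP; rewrite -subr_eq0 -oppr_eq0; apply/eqP; rewrite -[RHS]E; ring.
Qed.

(* Differentiating the first constraint along the flow of z^2 amounts to
   subtracting tr(Z_2 G^-1 R) from the trace of the recurrence shifted by 2,
   where R = 0 is the unshifted recurrence. *)
Lemma virasoro0_flow2 :
  x * (Y 0 3 + Y 1 2 - Y 2 1 - Y 3 0 - Y 0 1 ^+ 2 - 2 * Y 0 0 * Y 1 1
       - Y 1 0 ^+ 2)
  = - (2 * n%:R + a) * (Y 0 2 - Y 2 0 - Y 0 0 * Y 0 1 - Y 0 0 * Y 1 0)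
    + 2 * Y 0 0 - 2 * (Y 0 2 + Y 1 1 + Y 2 0).
Proof.
have /(congr1 (fun A => \tr (invmx G *m A))) := mxrecS 1.
rewrite mulmx0 mxtrace0 !mulmxDr !mulmxN !raddfD/= !raddfN/= -!scalemxAr !mxtraceZ.
rewrite !trace_deg_shift !mulmxA -!/(Z _) => E1.
have := congr1 (fun A => \tr (Z 2 *m (invmx G *m A))) mxrec0.
rewrite !mulmx0 mxtrace0 !mulmxDr !mulmxN !raddfD/= !raddfN/=.
rewrite -!scalemxAr !mxtraceZ.
(* Transposition and cyclicity identify the left derivative term with the right one, all Hankel
   matrices being symmetric. *)
have -> : \tr (Z 2 *m (invmx G *m (dermx^T *m G))) = \tr (Z 2 *m dermx).
  rewrite !mulmxA mxtrace_mulC !mulmxA mulmxV// mul1mx -mxtrace_tr.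
  by rewrite !trmx_mul trmxK trmx_inv !trmx_hankel mxtrace_mulC.
have -> : \tr (Z 2 *m (invmx G *m (degmx *m hankel 1)))
          = \tr (Z 1 *m degmx *m Z 2).
  rewrite -mxtrace_tr !trmx_mul !trmx_inv !trmx_hankel tr_diag_mx.
  by rewrite !mulmxA mxtrace_mulC !mulmxA.
rewrite (mulmxA (invmx G) G) (mulmxA (invmx G) (hankel 1)) mulVmx// mul1mx mulmx1.
rewrite -!/(Z _) (mxtrace_mulC (Z 2) (Z 1 *m degmx)).
rewrite (mxtrace_mulC (Z 2) (Z 1)) trace_shift_der => E2.
move: E1 E2.
rewrite trace_shift_diag_shift !trace_shift_shift !trace_shift_diag !trace_shift.
rewrite !big_ord_recl !big_ord0 /= /bump /= => E1 E2.
have := congr2 (fun u v => u - v) E1 E2; rewrite subrr /addn /subn /= => E.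
apply/eqP; rewrite -subr_eq0 -oppr_eq0; apply/eqP; rewrite -[RHS]E; ring.
Qed.

End Virasoro.

End HankelAlgebra.

(** * The flow of the Hankel coordinates *)

Section MatrixCalculus.
Variable R : realType.
Implicit Types x : R.

Let scalerE (a b : R) : a *: b = a * b. Proof. by []. Qed.

Lemma is_derive_bigsum (I : Type) (s : seq I) (P : pred I) (f : I -> R -> R) x
    (df : I -> R) : (forall i, is_derive x 1 (f i) (df i)) ->
  is_derive x 1 (fun y => \sum_(i <- s | P i) f i y) (\sum_(i <- s | P i) df i).
Proof.
move=> fD; elim: s => [|i s IH].
  rewrite big_nil (_ : (fun _ => _) = cst 0); first exact: is_derive_cst.
  by apply/funext => y; rewrite big_nil.
rewrite big_cons; case: ifPn => Pi.
  rewrite (_ : (fun _ => _) = f i + (fun y => \sum_(j <- s | P j) f j y)).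
    exact: is_deriveD.
  by apply/funext => y; rewrite big_cons Pi.
rewrite (_ : (fun _ => _) = (fun y => \sum_(j <- s | P j) f j y))//.
by apply/funext => y; rewrite big_cons (negbTE Pi).
Qed.

Lemma is_derive_bigprod (n : nat) (f : 'I_n -> R -> R) x (df : 'I_n -> R) :
  (forall i, is_derive x 1 (f i) (df i)) ->
  is_derive x 1 (fun y => \prod_(i < n) f i y)
    (\sum_(k < n) df k * \prod_(i < n | i != k) f i x).
Proof.
elim: n f df => [|n IH] f df fD.
  rewrite big_ord0 (_ : (fun _ => _) = cst 1); first exact: is_derive_cst.
  by apply/funext => y; rewrite big_ord0.
rewrite (_ : (fun _ => _) =
   f ord0 * (fun y => \prod_(i < n) f (lift ord0 i) y)); last first.
  by apply/funext => y; rewrite big_ord_recl.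
have := IH (fun i => f (lift ord0 i)) (fun i => df (lift ord0 i))
  (fun i => fD (lift ord0 i)).
move=> /(is_deriveM (fD ord0))/is_derive_eq; apply.
rewrite big_ord_recl addrC; congr (_ + _).
  rewrite scalerE mulrC; congr (_ * _).
  rewrite [RHS]big_mkcond big_ord_recl /= mul1r.
  by apply: eq_bigr => i _.
rewrite scalerE mulr_sumr; apply: eq_bigr => k _.
rewrite mulrCA; congr (_ * _).
rewrite [RHS]big_mkcond big_ord_recl /= -big_mkcond/=.
by congr (_ * _); apply: eq_bigl => i; rewrite (inj_eq lift_inj).
Qed.

(** Jacobi's formula: the product rule differentiates one row at a time, and expanding along that
    row yields the adjugate. *)
Lemma is_derive_det (n : nat) (A : R -> 'M[R]_n) x (dA : 'M[R]_n) :
  (forall i j, is_derive x 1 (fun y => A y i j) (dA i j)) ->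
  is_derive x 1 (fun y => \det (A y)) (\tr (\adj (A x) *m dA)).
Proof.
move=> AD; rewrite /determinant.
have termD (s : 'S_n) : is_derive x 1 (fun y => (-1) ^+ s * \prod_i A y i (s i))
    ((-1) ^+ s *
     \sum_(k < n) dA k (s k) * \prod_(i < n | i != k) A x i (s i)).
  have := is_derive_bigprod (fun i => AD i (s i)).
  by move=> /(is_deriveZ ((-1) ^+ s)).
have /is_derive_eq := is_derive_bigsum (index_enum _) predT termD; apply.
under eq_bigr do rewrite mulr_sumr.
rewrite exchange_big/= mxtrace_mulC; apply: eq_bigr => k _.
(* [A x] with its row [k] replaced by that of [dA]; the cofactors along row [k] are unchanged. *)
pose B : 'M[R]_n := \matrix_(i, j) if i == k then dA k j else A x i j.
transitivity (\det B).
  apply: eq_bigr => s _; congr (_ * _); rewrite [RHS](bigD1 k)//=.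
  rewrite mxE eqxx; congr (_ * _); apply: eq_bigr => i /negbTE ik.
  by rewrite mxE ik.
rewrite (expand_det_row _ k) mxE; apply: eq_bigr => j _.
rewrite !mxE eqxx; congr (_ * _); rewrite /cofactor; congr (_ * \det _).
by apply/matrixP => p q; rewrite !mxE eq_sym (negbTE (neq_lift _ _)).
Qed.

(** By Cramer's rule the entries of the inverse are quotients of determinants. *)
Lemma derivable_invmx (n : nat) (A : R -> 'M[R]_n) x :
  (forall i j, derivable (fun y => A y i j) x 1) ->
  (forall y, A y \in unitmx) ->
  forall i j, derivable (fun y => invmx (A y) i j) x 1.
Proof.
move=> AD Au i j.
have -> : (fun y => invmx (A y) i j) =
  (fun y => (\det (A y))^-1) * (fun y => \adj (A y) i j).
  by apply/funext => y; rewrite /invmx Au [LHS]mxE.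
apply: derivableM.
  apply: (@derivableV _ _ (fun y => \det (A y))).
    by have := Au x; rewrite unitmxE unitfE.
  pose dA : 'M[R]_n := \matrix_(i, j) 'D_1 (fun y => A y i j) x.
  have dAE p q : is_derive x 1 (fun y => A y p q) (dA p q).
    by rewrite mxE; exact: derivableP.
  by have [] := is_derive_det dAE.
rewrite (_ : (fun _ => _) =
   (-1) ^+ (j + i) \*: (fun y => \det (row' j (col' i (A y))))); last first.
  by apply/funext => y; rewrite mxE.
apply: derivableZ.
pose dB : 'M[R]_n.-1 := \matrix_(p, q) 'D_1 (fun y => A y (lift j p) (lift i q)) x.
have dBE p q : is_derive x 1 (fun y => row' j (col' i (A y)) p q) (dB p q).
  rewrite mxE; have -> : (fun y => row' j (col' i (A y)) p q) =
    (fun y => A y (lift j p) (lift i q)) by apply/funext => y; rewrite !mxE.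
  exact: derivableP.
by have [] := is_derive_det dBE.
Qed.

End MatrixCalculus.

(** * Derivatives of the Hankel determinant and of the coordinates *)

Section HankelFlow.
Variables (R : realType) (n : nat) (m : nat -> R -> R).
Hypothesis mD : forall k (x : R), is_derive x 1 (m k) (m k.+1 x).
Hypothesis Gu : forall x : R, hankel n (m^~ x) 0 \in unitmx.

Local Notation Y r l x := (hankel_coord n (m^~ x) r l).
Local Notation G x := (hankel n (m^~ x) 0).

Lemma is_derive_hankel k (x : R) i j :
  is_derive x 1 (fun y => hankel n (m^~ y) k i j) (hankel n (m^~ x) k.+1 i j).
Proof.
rewrite mxE addnS (_ : (fun _ => _) = m (i + j + k)%N)//.
by apply/funext => y; rewrite mxE.
Qed.

(** Jacobi's formula makes the logarithmic derivative the trace of [Z 1], which is the single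
    coordinate [Y 0 0]. *)
Lemma is_derive_hankel_det (x : R) :
  is_derive x 1 (fun y => \det (G y)) (\det (G x) * Y 0 0 x).
Proof.
have /is_derive_eq := is_derive_det (@is_derive_hankel 0 x); apply.
have := trace_shift (Gu x) 0; rewrite big_ord1 subn0 => <-.
rewrite /hankel_shift -mxtraceZ; congr (\tr _).
rewrite /invmx Gu scalemxAl scalerA divff ?scale1r//.
by have := Gu x; rewrite unitmxE unitfE.
Qed.

(** Differentiating [G v = u_l] gives [v' = G^-1 u_(l+1) - Z_1 v]; the component of [Z_1 v] on
    [z^(n-1-r)] is [Y r 0 * Y 0 l + Y r.+1 l]. *)
Lemma is_derive_hankel_coord r l (x : R) :
  is_derive x 1 (fun y => Y r l y)
    (Y r l.+1 x - Y r 0 x * Y 0 l x - Y r.+1 l x).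
Proof.
have [nr|rn] := leqP n r.
  rewrite !(hankel_coord_ge _ _ nr) !(hankel_coord_ge _ _ (leqW nr)).
  rewrite mul0r !subr0 (_ : (fun _ => _) = cst 0); first exact: is_derive_cst.
  by apply/funext => y; rewrite hankel_coord_ge.
pose v y : 'cV[R]_n := invmx (G y) *m hankel_col n (m^~ y) l.
have uD i : is_derive x 1 (fun y => hankel_col n (m^~ y) l i 0)
                          (hankel_col n (m^~ x) l.+1 i 0).
  rewrite mxE !addnS (_ : (fun _ => _) = m (i + (n + l))%N)//.
  by apply/funext => y; rewrite mxE.
(* Cramer's rule supplies derivability first; the value of the derivative is then read off the
   linear system. *)
have vD i : derivable (fun y => v y i 0) x 1.
  rewrite (_ : (fun _ => _) = \sum_(j < n)
     ((fun y => invmx (G y) i j) * (fun y => hankel_col n (m^~ y) l j 0))).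
    apply: derivable_sum => j; apply: derivableM.
      apply: derivable_invmx => // p q.
      by have [] := is_derive_hankel 0 x p q.
    by have [] := uD j.
  by apply/funext => y; rewrite mxE fct_sumE.
pose dv : 'cV[R]_n := \col_i 'D_1 (fun y => v y i 0) x.
have vE y : G y *m v y = hankel_col n (m^~ y) l by rewrite mulKVmx.
have dvE : hankel n (m^~ x) 1 *m v x + G x *m dv = hankel_col n (m^~ x) l.+1.
  apply/colP => i; have := uD i.
  have -> : (fun y => hankel_col n (m^~ y) l i 0) =
     (fun y => \sum_(j < n) ((fun y => G y i j) * (fun y => v y j 0)) y).
    by apply/funext => y; rewrite -vE mxE.
  have H (j : 'I_n) := is_deriveM (is_derive_hankel 0 x i j)
    (derivableP (vD j)).
  have := @is_derive_bigsum _ _ (index_enum 'I_n) predT _ _ _ H.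
  move=> [_ E1] [_ E2]; rewrite -[RHS](etrans (esym E1) E2) mxE.
  under eq_bigr do rewrite addrC.
  rewrite big_split/= !mxE; congr (_ + _); apply: eq_bigr => j _ //.
    by rewrite mulrC !mxE.
  by rewrite !mxE.
have {}dvE : dv = invmx (G x) *m hankel_col n (m^~ x) l.+1
     - hankel_shift n (m^~ x) 1 *m v x.
  rewrite -dvE mulmxDr mulKmx// /hankel_shift -mulmxA.
  by rewrite addrC addKr.
rewrite (_ : (fun _ => _) = (fun y => v y (rev_ord (Ordinal rn)) 0)); last first.
  by apply/funext => y; rewrite (hankel_coordE _ (Ordinal rn)).
have /is_derive_eq := derivableP (vD (rev_ord (Ordinal rn))); apply.
have -> : 'D_1 (fun y => v y (rev_ord (Ordinal rn)) 0) x =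
   dv (rev_ord (Ordinal rn)) 0 by rewrite mxE.
rewrite dvE.
have -> : v x = \col_i (fun s => Y s l x) (rev_ord i).
  by apply/colP => i; rewrite [RHS]mxE hankel_coordE rev_ordK.
rewrite mxE [X in _ + X]mxE -(hankel_coordE _ (Ordinal rn)).
rewrite (@shift_col_rev _ n (m^~ x) (Gu x) 0 (fun s => Y s l x) (Ordinal rn)).
  by rewrite big_ord1 addn1 opprD addrA.
by move=> s /hankel_coord_ge ->.
Qed.

End HankelFlow.

(** * KP equation *)

Section HankelODE.
Variables (R : realType) (n : nat) (m : nat -> R -> R) (a b C : R).
Hypothesis mD : forall k (x : R), is_derive x 1 (m k) (m k.+1 x).
Hypothesis Gu : forall x : R, hankel n (m^~ x) 0 \in unitmx.
Hypothesis mrec : forall x k, k%:R * m k.-1 x - (k%:R + 2 + a) * m k.+1 x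
  + x * (m k x - m k.+2 x) - b * m k x = 0.
Hypothesis C0 : C != 0.

Let y r l : R -> R := fun x => hankel_coord n (m^~ x) r l.
Let dy r l : R -> R := y r l.+1 - y r 0 * y 0 l - y r.+1 l.

Let yD r l (x : R) : is_derive x 1 (y r l) (dy r l x).
Proof. exact: is_derive_hankel_coord. Qed.
Local Existing Instance yD.

Let T x := C * \det (hankel n (m^~ x) 0).
Let H x := x * (derive1 T x / T x).
(** [h] is the logarithmic derivative of [T], and [h1], [h2], [h3] are its successive derivatives,
    computed by the flow of the coordinates. *)
Let h := y 0 0.
Let h1 := dy 0 0.
Let h2 : R -> R := dy 0 1 - 2 \*: (y 0 0 * dy 0 0) - dy 1 0.
Let h3 : R -> R := dy 0 2 - 2 \*: dy 1 1 + dy 2 0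
  - 3 \*: (dy 0 0 * y 0 1 + y 0 0 * dy 0 1)
  + 6 \*: (y 0 0 * y 0 0 * dy 0 0)
  + 3 \*: (dy 0 0 * y 1 0 + y 0 0 * dy 1 0).

Let scale (u v : R) : u *: v = u * v. Proof. by []. Qed.
Let scalefE (u : R) (f : R -> R) x : (u \*: f) x = u * f x. Proof. by []. Qed.
Let addfE (f g : R -> R) x : (f + g) x = f x + g x. Proof. by []. Qed.
Let oppfE (f : R -> R) x : (- f) x = - f x. Proof. by []. Qed.
Let mulfE (f g : R -> R) x : (f * g) x = f x * g x. Proof. by []. Qed.
Let dyE r l x : dy r l x = y r l.+1 x - y r 0 x * y 0 l x - y r.+1 l x.
Proof. by []. Qed.

Let fE := (scale, scalefE, addfE, oppfE, mulfE).

Let h1D (x : R) : is_derive x 1 h1 (h2 x).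
Proof.
apply: is_derive_eq; rewrite /h2 !fE !dyE; ring.
Qed.

Let h2E : h2 = y 0 2 - 2 \*: y 1 1 + y 2 0 - 3 \*: (y 0 0 * y 0 1)
  + 2 \*: (y 0 0 * y 0 0 * y 0 0) + 3 \*: (y 0 0 * y 1 0).
Proof. by apply/funext => x; rewrite /h2 !fE !dyE; ring. Qed.

Let h2D (x : R) : is_derive x 1 h2 (h3 x).
Proof.
rewrite h2E; apply: is_derive_eq; rewrite /h3 !fE !dyE; ring.
Qed.

Lemma is_derive_scaled_det (x : R) : is_derive x 1 T (T x * h x).
Proof.
have /is_derive_eq := is_deriveZ C (is_derive_hankel_det mD Gu x); apply.
by rewrite scale /T mulrA.
Qed.

Lemma scaled_det_logderiv : H = id * h.
Proof.
apply/funext => x; rewrite /H mulfE; congr (_ * _).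
have [_ E] := is_derive_scaled_det x; rewrite derive1E E mulrC mulKf//.
by rewrite mulf_neq0//; have := Gu x; rewrite unitmxE unitfE.
Qed.

Let HD (x : R) : is_derive x 1 H (h x + x * h1 x).
Proof.
rewrite scaled_det_logderiv; have /is_derive_eq :=
  is_deriveM (is_derive_id x 1) (yD 0 0 x); apply.
rewrite !scale /= /h1 /h; ring.
Qed.

Let H1E : derive1 H = h + id * h1.
Proof. by apply/funext => x; rewrite derive1E; have [_ ->] := HD x. Qed.

Let H1D (x : R) : is_derive x 1 (derive1 H) (2 * h1 x + x * h2 x).
Proof.
rewrite H1E; have /is_derive_eq := is_deriveD (yD 0 0 x)
  (is_deriveM (is_derive_id x 1) (h1D x)); apply.
rewrite !scale /= /h1; ring.
Qed.

Let H2E : derive1n 2 H = 2 \*: h1 + id * h2.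
Proof.
by apply/funext => x; rewrite derive1nS derive1n1 derive1E; have [_ ->] := H1D x.
Qed.

Let H2D (x : R) : is_derive x 1 (derive1n 2 H) (3 * h2 x + x * h3 x).
Proof.
rewrite H2E; have /is_derive_eq := is_deriveD (is_deriveZ 2 (h1D x))
  (is_deriveM (is_derive_id x 1) (h2D x)); apply.
rewrite !scale /=; ring.
Qed.

Let H3E x : derive1n 3 H x = 3 * h2 x + x * h3 x.
Proof. by rewrite derive1nS derive1E; have [_ ->] := H2D x. Qed.

Let s : R := 2 * n%:R + a.
Let q2 := y 0 1 + y 1 0.
Let q2' := dy 0 1 + dy 1 0.
Let q3 := y 0 2 + y 1 1 + y 2 0.
Let q3' := dy 0 2 + dy 1 1 + dy 2 0.
(** The derivative of [q_2] along the flow of [z^2]: the trace of [Z 4] minus the trace of the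
    square of [Z 2]. *)
Let q22 x := y 0 3 x + y 1 2 x - y 2 1 x - y 3 0 x - y 0 1 x ^+ 2
  - 2 * y 0 0 x * y 1 1 x - y 1 0 x ^+ 2.

Let E0 x : x * q2 x = n%:R * (x - b) - s * h x.
Proof. exact: (@virasoro0 _ n (m^~ x) (Gu x) a b x (mrec x)). Qed.

(** The flow of [y 0 0] turns the term [Y 0 1 - Y 1 0] of [virasoro1] into [h' + h^2]. *)
Let E1 x : x * q3 x = n%:R ^+ 2 - s * q2 x - (h1 x + h x ^+ 2) + (x - b) * h x.
Proof.
apply: etrans (@virasoro1 _ n (m^~ x) (Gu x) a b x (mrec x)) _.
rewrite -!/(y _ _ x) /h1 dyE /q2 addfE /h /s; ring.
Qed.

Let E2 x : x * q22 x = - s * q2' x + 2 * h x - 2 * q3 x.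
Proof.
apply: etrans (@virasoro0_flow2 _ n (m^~ x) (Gu x) a b x (mrec x)) _.
rewrite -!/(y _ _ x) /q2' addfE !dyE /q3 !fE /h /s; ring.
Qed.

Let derive_unique (f : R -> R) (x u v : R) :
  is_derive x 1 f u -> is_derive x 1 f v -> u = v.
Proof. by move=> [_ <-] [_ <-]. Qed.

(** [E0] holds for every [x], so both sides may be differentiated; [E1'] arises from [E1] in the
    same way. *)
Let E0' x : q2 x + x * q2' x = n%:R - s * h1 x.
Proof.
have L : is_derive x 1 (id * q2) (q2 x + x * q2' x).
  by apply: is_derive_eq; rewrite /q2 /q2' !fE /=; ring.
apply: derive_unique L _.
rewrite (_ : id * q2 = n%:R \*: id - cst (n%:R * b) - s \*: h); last first.
  by apply/funext => z; rewrite mulfE E0 !fE /=; ring.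
by apply: is_derive_eq; rewrite !fE /h1 /=; ring.
Qed.

Let E1' x : q3 x + x * q3' x =
  - s * q2' x - h2 x - 2 * h x * h1 x + h x + (x - b) * h1 x.
Proof.
have L : is_derive x 1 (id * q3) (q3 x + x * q3' x).
  by apply: is_derive_eq; rewrite /q3 /q3' !fE /=; ring.
apply: derive_unique L _.
rewrite (_ : id * q3 = cst (n%:R ^+ 2) - s \*: q2 - (y 0 1 - y 1 0) + id * h - b \*: h).
  by apply: is_derive_eq; rewrite /h2 /q2' /h1 /h !fE !dyE /=; ring.
by apply/funext => z; rewrite mulfE E1 /h1 /h !fE dyE /=; ring.
Qed.

(* The KP equation for log det, an identity in the coordinates. *)
Let KP x : h3 x + 6 * h1 x ^+ 2 + 3 * q22 x - 4 * q3' x = 0.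
Proof. rewrite /h3 /q22 /q3' /h1 !fE !dyE; ring. Qed.

Lemma scaled_det_ode (x : R) :
  x ^+ 2 * derive1n 3 H x + x * derive1n 2 H x + 6 * x * (derive1 H x) ^+ 2
     - (4 * H x + 4 * x ^+ 2 - 4 * b * x + (2 * n%:R + a) ^+ 2) * derive1 H x
     + (4 * x - 2 * b) * H x + 2 * n%:R * (n%:R + a) * x
     - b * n%:R * (2 * n%:R + a) = 0.
Proof.
rewrite H3E H2E H1E scaled_det_logderiv !fE.
(* The multipliers carry out the elimination: the [E2] and [E1'] terms cancel [q22] and [q3'] in
   [x^3] times KP, then the [E0'], [E1] and [E0] terms cancel the remaining [q2'], [q3] and [q2]. *)
transitivity (x ^+ 3 * (h3 x + 6 * h1 x ^+ 2 + 3 * q22 x - 4 * q3' x)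
  - 3 * x ^+ 2 * (x * q22 x - (- s * q2' x + 2 * h x - 2 * q3 x))
  + 4 * x ^+ 2 * (q3 x + x * q3' x -
      (- s * q2' x - h2 x - 2 * h x * h1 x + h x + (x - b) * h1 x))
  - s * x * (q2 x + x * q2' x - (n%:R - s * h1 x))
  + 2 * x * (x * q3 x -
      (n%:R ^+ 2 - s * q2 x - (h1 x + h x ^+ 2) + (x - b) * h x))
  - s * (x * q2 x - (n%:R * (x - b) - s * h x))).
  rewrite /s /=; ring.
by rewrite KP E2 E1' E0' E1 E0 !subrr; ring.
Qed.

Lemma scaled_det_derivable (x : R) :
  [/\ derivable T x 1, derivable H x 1, derivable (derive1 H) x 1
    & derivable (derive1n 2 H) x 1].
Proof.
split; [by have [] := is_derive_scaled_det x | by have [] := HD x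
  | by have [] := H1D x | by have [] := H2D x].
Qed.

Lemma scaled_det_init :
  H 0 = 0 /\ (2 * n%:R + a) * derive1 H 0 = - n%:R * b.
Proof.
split; first by rewrite /H mul0r.
(* At [x = 0] one has [H' = h], and the first Virasoro constraint loses its left side, which
   determines [h 0]. *)
rewrite H1E addfE mulfE mul0r addr0; have := E0 0; rewrite mul0r /s => E.
by apply/eqP; rewrite -subr_eq0 -oppr_eq0; apply/eqP; rewrite [RHS]E; ring.
Qed.

End HankelODE.

(** * Primitives of integrable functions *)

Section ImproperFTC.
Local Open Scope classical_set_scope.
Local Open Scope ring_scope.
Variable R : realType.
Local Notation mu := (@lebesgue_measure R).
Implicit Types (f F : R -> R) (a b : R).

(** The integrand may blow up at the endpoints. The indefinite integral is still continuous on the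
    closed interval and has the same derivative inside as [F], so the mean value theorem makes their
    difference constant. *)
Lemma integrable_FTC2 f F a b : a < b ->
  mu.-integrable `[a, b] (EFin \o f) ->
  {in `]a, b[, continuous f} ->
  derivable_oo_LRcontinuous F a b ->
  {in `]a, b[, derive1 F =1 f} ->
  \int[mu]_(x in `[a, b]) f x = F b - F a.
Proof.
move=> ab fi fc FD F'.
pose G x := \int[mu]_(t in `[a, x]) f t.
have Gc : {within `[a, b], continuous G}.
  exact: parameterized_integral_continuous (ltW ab) fi.
have Fc := derivable_oo_LRcontinuous_within FD.
have GD x : x \in `]a, b[ -> is_derive x 1 G (f x).
  move=> xab; move: (xab); rewrite in_itv/= => /andP[ax xb].
  have [|GDx GE] := continuous_FTC1_closed xb fi ax; first exact: fc.
  by rewrite -GE derive1E; exact: derivableP.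
have DD x : x \in `]a, b[ -> is_derive x 1 (F - G) ((fun=> 0) x).
  move=> xab; have [Fd _ _] := FD.
  have := is_deriveB (derivableP (Fd _ xab)) (GD _ xab).
  by rewrite -derive1E F'// subrr.
have DC : {within `[a, b], continuous (F - G)}.
  by move=> x; apply: cvgB; [exact: Fc | exact: Gc].
have [c _] := MVT_segment (ltW ab) DD DC.
rewrite mul0r /= => /eqP; rewrite subr_eq0 => /eqP E.
have Ga : G a = 0 by rewrite /G set_itv1 Rintegral_set1.
have : F b - G b = F a - G a by exact: E.
rewrite Ga /G => E'; lra.
Qed.

(** On closed subintervals the integral is a difference of values of [F], hence at most [2 * M];
    monotone convergence carries the bound to the whole interval. *)
Lemma ge0_integrable_primitive f F a b (M : R) : a < b ->
  measurable_fun `[a, b] f ->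
  {in `]a, b[, forall x, 0 <= f x} ->
  {in `]a, b[, continuous f} ->
  {in `]a, b[, forall x : R, is_derive x 1 F (f x)} ->
  {in `]a, b[, forall x, `|F x| <= M} ->
  mu.-integrable `[a, b] (EFin \o f).
Proof.
move=> ab fm f0 fc FD FM.
have fmo : measurable_fun `]a, b[ f.
  by apply: measurable_funS fm => //; exact: subset_itv_oo_cc.
(* The denominator starts at 3 so that [2 * e n < b - a] already for [n = 0]. *)
pose e n : R := (b - a) / n.+3%:R.
have e0 n : 0 < e n by rewrite divr_gt0// subr_gt0.
have e2 n : a + e n < b - e n.
  suff : 3 * e n <= b - a by have := e0 n; lra.
  by rewrite /e mulrCA ger_pMr ?subr_gt0// ler_pdivrMr// mul1r ler_nat.
have eS n p : (n <= p)%N -> e p <= e n.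
  by move=> np; rewrite ler_pM2l ?subr_gt0// lef_pV2 ?posrE// ler_nat.
pose S n : set R := `[a + e n, b - e n]%classic.
have So n : S n `<=` `]a, b[%classic.
  by move=> x; rewrite /S /= !in_itv/= => /andP[? ?]; have := e0 n; lra.
have SU : \bigcup_n S n = `]a, b[%classic.
  apply/seteqP; split => [x [n _]|x xab]; first exact: So.
  move: (xab); rewrite /= in_itv/= => /andP[ax xb].
  pose d := Num.min (x - a) (b - x).
  have d0 : 0 < d by rewrite lt_min !subr_gt0 ax xb.
  pose N := Num.bound ((b - a) / d).
  exists N => //; rewrite /S /= in_itv/=.
  have : e N <= d.
    rewrite /e ler_pdivrMr// mulrC -ler_pdivrMr//.
    apply: (@le_trans _ _ N%:R); last by rewrite ler_nat; lia.
    by apply/ltW/archi_boundP; rewrite divr_ge0 ?ltW// subr_gt0.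
  by rewrite /d le_min => /andP[? ?]; lra.
have fiS n : (\int[mu]_(x in S n) (f x)%:E = (F (b - e n) - F (a + e n))%:E)%E.
  rewrite EFinB; apply: continuous_FTC2 => //.
  - apply/continuous_within_itvP => //.
    have fcS x : S n x -> {for x, continuous f} by move=> /So; exact: fc.
    have fl : {for a + e n, continuous f}.
      by apply: fcS; rewrite /S /= in_itv/= lexx ltW.
    have fr : {for b - e n, continuous f}.
      by apply: fcS; rewrite /S /= in_itv/= lexx ltW.
    split; [|exact: cvg_at_right_filter|exact: cvg_at_left_filter].
    by move=> x /subset_itv_oo_cc /fcS.
  - have FDS x : S n x -> derivable F x 1 by move=> /So /FD [].
    have FcS x : S n x -> {for x, continuous F}.
      by move=> /FDS /derivable1_diffP /differentiable_continuous.
    split.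
    + by move=> x /subset_itv_oo_cc /FDS.
    + by apply: cvg_at_right_filter; apply: FcS; rewrite /S /= in_itv/= lexx ltW.
    + by apply: cvg_at_left_filter; apply: FcS; rewrite /S /= in_itv/= lexx ltW.
  - move=> x /subset_itv_oo_cc /So /FD [_ <-]; exact: derive1E.
have cvgS : (\int[mu]_(x in S n) (f x)%:E)%E @[n --> \oo] -->
    (\int[mu]_(x in `]a, b[) (f x)%:E)%E.
  rewrite -SU; apply: ge0_nondecreasing_set_cvg_integral.
  - move=> n p np; apply/subsetPset => x; rewrite /S /= !in_itv/= => /andP[? ?].
    by have := eS _ _ np; lra.
  - by move=> n; exact: measurable_itv.
  - move=> n; apply/measurable_EFinP; apply: measurable_funS fmo => //; exact: So.
  - by move=> n x /So xab; rewrite lee_fin f0.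
have fle : (\int[mu]_(x in `]a, b[) (f x)%:E <= (2 * M)%:E)%E.
  rewrite -(cvg_lim _ cvgS)//; apply: lime_le; first by apply/cvg_ex; eexists; exact: cvgS.
  apply: nearW => n; rewrite fiS lee_fin.
  have xl : `]a, b[%classic (a + e n) by apply: (So n); rewrite /S /= in_itv/= lexx ltW.
  have xr : `]a, b[%classic (b - e n) by apply: (So n); rewrite /S /= in_itv/= lexx ltW.
  have := FM _ xl; have := FM _ xr; rewrite !ler_norml => /andP[? ?] /andP[? ?].
  lra.
apply/integrableP; split; first exact/measurable_EFinP.
rewrite -integral_itv_bndo_bndc; last first.
  apply: measurableT_comp => //; apply/measurable_EFinP.
  by apply: measurable_funS fm => //; exact: subset_itv_co_cc.
rewrite -integral_itv_obnd_cbnd; last first.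
  by apply: measurableT_comp => //; apply/measurable_EFinP.
apply: le_lt_trans (ltry (2 * M)); apply: le_trans fle.
apply: ge0_le_integral => //=.
- by apply/measurable_EFinP; apply: measurableT_comp.
- by apply/measurable_EFinP.
- by move=> x xab; rewrite lee_fin ger0_norm// f0.
Qed.

End ImproperFTC.

(** * Moments of the Jacobi weight *)

Lemma Rintegral_linear (d : measure_display) (T : measurableType d)
    (R : realType) (mu : {measure set T -> \bar R}) (I : Type) (r : seq I)
    (c : I -> R) (f : I -> T -> R) (D : set T) : measurable D ->
  (forall i, mu.-integrable D (EFin \o f i)) ->
  \int[mu]_(z in D) (\sum_(i <- r) c i * f i z) =
    \sum_(i <- r) c i * \int[mu]_(z in D) f i z.
Proof.
move=> mD fi.
have cfi i : mu.-integrable D (EFin \o (fun z => c i * f i z)).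
  by have := integrableZl mD (c i) (fi i).
elim: r => [|i r IH].
  under eq_Rintegral do rewrite big_nil.
  by rewrite Rintegral_cst// mul0r big_nil.
under eq_Rintegral do rewrite big_cons.
rewrite big_cons -IH -RintegralZl// RintegralD//.
rewrite (_ : _ \o _ = fun z => (\sum_(i <- r) (c i * f i z)%:E)%R).
  by apply: integrable_sum => // j _; exact: cfi.
by apply/funext => z /=; rewrite -sumEFin.
Qed.

Section JacobiMoments.
Local Open Scope classical_set_scope.
Local Open Scope ring_scope.
Variables (R : realType).
Local Notation mu := (@lebesgue_measure R).
Implicit Types (p s x z : R) (k : nat).

Let itv11 z : z \in `]-1, 1[ -> -1 < z < 1. Proof. by rewrite in_itv. Qed.

Lemma is_derive_powR_affine p s z : 0 < 1 + s * z ->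
  is_derive z 1 (fun y => (1 + s * y) `^ p) (p * s * (1 + s * z) `^ (p - 1)).
Proof.
move=> z0; have gD : is_derive z 1 (fun y => 1 + s * y) s.
  have /is_derive_eq := is_deriveD (is_derive_cst (1 : R) z 1)
    (is_deriveZ s (is_derive_id z 1)); apply.
  by rewrite add0r; exact: mulr1.
have /is_derive_eq := @is_derive1_comp _ (@powR R ^~ p)
  (fun y => 1 + s * y) z _ _ (is_derive1_powR p z0) gD; apply; ring.
Qed.

Lemma continuous_powR_affine p s z : 0 < 1 + s * z ->
  {for z, continuous (fun y => (1 + s * y) `^ p)}.
Proof.
move=> z0; have [D _] := is_derive_powR_affine p z0.
exact/differentiable_continuous/derivable1_diffP.
Qed.

Lemma measurable_powR_affine p s (D : set R) :
  measurable_fun D (fun z => (1 + s * z) `^ p).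
Proof.
apply: (measurable_funS measurableT) => //.
apply: (measurableT_comp (measurable_powR p)).
by apply: measurable_funD => //; apply: measurable_funM.
Qed.

(** The values [s = 1] and [s = -1] treat both endpoint singularities at once. The primitive has
    exponent [p + 1 > 0], hence is bounded. *)
Lemma integrable_powR_affine p s : s ^+ 2 = 1 -> -1 < p ->
  mu.-integrable `[-1, 1] (EFin \o (fun z => (1 + s * z) `^ p)).
Proof.
move=> s1 p1.
have sE : s = 1 \/ s = -1.
  by move/eqP: s1; rewrite sqrf_eq1 => /orP[] /eqP; [left|right].
have s0 : s != 0 by case: sE => ->; rewrite ?oppr_eq0 oner_eq0.
have q0 : 0 < p + 1 by lra.
have g0 z : z \in `]-1, 1[ -> 0 < 1 + s * z < 2.
  by move=> /itv11/andP[? ?]; case: sE => ->; lra.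
apply: (@ge0_integrable_primitive _ _
  (fun z => (s * (p + 1))^-1 * (1 + s * z) `^ (p + 1)) _ _
  (`|(s * (p + 1))^-1| * 2 `^ (p + 1))) => //.
- exact: measurable_powR_affine.
- by move=> z _; exact: powR_ge0.
- by move=> z /g0/andP[z0 _]; exact: continuous_powR_affine.
- move=> z /g0/andP[z0 _].
  have /is_derive_eq := is_deriveZ (s * (p + 1))^-1 (is_derive_powR_affine (p + 1) z0).
  apply; rewrite addrK -[_ *: _]/(_ * _) mulrA (mulrC (p + 1)) mulVf ?mul1r//.
  by rewrite mulf_neq0// gt_eqF.
- move=> z /g0/andP[z0 z2]; rewrite normrM ler_wpM2l//.
  by rewrite ger0_norm ?powR_ge0// ge0_ler_powR ?nnegrE// ltW.
Qed.

Variables (alpha beta : R).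
Hypotheses (alpha1 : -1 < alpha) (beta1 : -1 < beta).

Let w z : R := (1 - z) `^ alpha * (1 + z) `^ beta.

Let powR_le12 p (t : R) : 1 <= t <= 2 -> t `^ p <= 1 + 2 `^ p.
Proof.
move=> /andP[t1 t2]; have := powR_ge0 2 p.
case: (leP 0 p) => [p0|/ltW p0] h.
  have := ge0_ler_powR p0 (_ : t \in Num.nneg) (_ : 2 \in Num.nneg) t2.
  rewrite !nnegrE => /(_ (le_trans ler01 t1) (ler0n _ 2)) ?; lra.
have := ler_powR t1 p0; rewrite powRr0; lra.
Qed.

Let affN z : 1 - z = 1 + (-1) * z. Proof. by rewrite mulN1r. Qed.
Let affP z : 1 + z = 1 + 1 * z. Proof. by rewrite mul1r. Qed.

Let w_measurable (D : set R) : measurable_fun D w.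
Proof.
rewrite (_ : w = (fun z => (1 + (-1) * z) `^ alpha * (1 + 1 * z) `^ beta)).
  by apply: measurable_funM; exact: measurable_powR_affine.
by apply/funext => z; rewrite mulN1r mul1r.
Qed.

Let w_ge0 z : 0 <= w z. Proof. by rewrite mulr_ge0// powR_ge0. Qed.

(** On each half of the interval one of the two powers has its base in [[1, 2]] and is bounded, so
    the product is dominated by a multiple of the sum of the powers. *)
Let w_integrable : mu.-integrable `[-1, 1] (EFin \o w).
Proof.
pose C := (1 + 2 `^ alpha) + (1 + 2 `^ beta).
pose g z : R := (1 + (-1) * z) `^ alpha + (1 + 1 * z) `^ beta.
have gi : mu.-integrable `[-1, 1] (EFin \o g).
  rewrite (_ : EFin \o g = ((EFin \o (fun z => (1 + (-1) * z) `^ alpha)%R) \+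
     (EFin \o (fun z => (1 + 1 * z) `^ beta)%R))%E)//.
  apply: integrableD => //; apply: integrable_powR_affine => //; ring.
have : mu.-integrable `[-1, 1] (fun z => C%:E * (EFin \o g) z)%E.
  exact: integrableZl.
apply: le_integrable => //.
  by apply/measurable_EFinP; exact: w_measurable.
move=> z; rewrite /= in_itv/= => /andP[z1 z2]; rewrite lee_fin.
rewrite !ger0_norm// ?mulr_ge0 ?addr_ge0 ?powR_ge0//.
rewrite /g -affN -affP /w /C.
have A0 := powR_ge0 (1 - z) alpha; have B0 := powR_ge0 (1 + z) beta.
have P0 := powR_ge0 2 alpha; have Q0 := powR_ge0 2 beta.
case: (leP 0 z) => z0.
  have B1 : (1 + z) `^ beta <= 1 + 2 `^ beta by apply: powR_le12; lra.
  apply: (le_trans (ler_wpM2l A0 B1)); rewrite mulrC.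
  by apply: ler_pM => //; lra.
have A1 : (1 - z) `^ alpha <= 1 + 2 `^ alpha by apply: powR_le12; lra.
apply: (le_trans (ler_wpM2r B0 A1)).
by apply: ler_pM => //; lra.
Qed.

Lemma integrable_continuous_jacobi (g : R -> R) : continuous g ->
  mu.-integrable `[-1, 1] (EFin \o (fun z => g z * w z)).
Proof.
move=> gc; have [c _ cM] : exists2 c, c \in `[-1, 1]%R &
    forall t, t \in `[-1, 1]%R -> `|g t| <= `|g c|.
  apply: EVT_max; first by lra.
  apply: continuous_subspaceT => z; apply: continuous_comp; first exact: gc.
  exact: norm_continuous.
apply: (@integrableMr _ _ _ mu `[-1, 1]%classic _ g (EFin \o w)) => //.
  apply: measurable_funTS; exact: continuous_measurable_fun.
exists `|g c|; split; first exact: num_real.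
move=> N gN z /= zD; apply: le_trans (ltW gN); exact: cM.
Qed.

Lemma jweightE x z : jweight alpha beta x z = expR (x * z) * w z.
Proof. by rewrite /jweight mulrA. Qed.

Let expRx_continuous x : continuous (fun z : R => expR (x * z)).
Proof.
move=> z; apply: (@continuous_comp _ _ _ (fun z => x * z) expR).
  by apply: cvgM; [exact: cvg_cst | exact: cvg_id].
exact: continuous_expR.
Qed.

Lemma integrable_jweight (g : R -> R) x : continuous g ->
  mu.-integrable `[-1, 1] (EFin \o (fun z => g z * jweight alpha beta x z)).
Proof.
move=> gc; rewrite (_ : (fun z => _) = (fun z => g z * expR (x * z) * w z)).
  apply: integrable_continuous_jacobi => z.
  by apply: cvgM; [exact: gc | exact: expRx_continuous].
by apply/funext => z; rewrite jweightE mulrA.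
Qed.

Definition jmoment k x : R :=
  \int[mu]_(z in `[-1, 1]) (z ^+ k * jweight alpha beta x z).

Lemma integrable_jmoment k x :
  mu.-integrable `[-1, 1] (EFin \o (fun z => z ^+ k * jweight alpha beta x z)).
Proof. by apply: integrable_jweight => z; exact: exprn_continuous. Qed.

Let is_derive_jweight k z (x : R) :
  is_derive x 1 (fun y => z ^+ k * jweight alpha beta y z)
    (z ^+ k.+1 * jweight alpha beta x z).
Proof.
have gD : is_derive x 1 (fun y : R => z *: y) z.
  by have /is_derive_eq := is_deriveZ z (is_derive_id x 1); apply; exact: mulr1.
have eD := @is_derive1_comp _ expR (fun y => z *: y) x _ _ (is_derive_expR _) gD.
have /is_derive_eq := is_deriveZ (z ^+ k * w z) eD.
rewrite (_ : _ \*: _ = (fun y => z ^+ k * jweight alpha beta y z)); last first.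
  apply/funext => y; rewrite jweightE (mulrC y) -[LHS]/(_ * _).
  by rewrite -mulrA (mulrC (w z)).
apply; rewrite jweightE (mulrC x) -[_ *: _]/(_ * _) -[z *: x]/(z * x) exprS; ring.
Qed.

Lemma is_derive_jmoment k x : is_derive x 1 (jmoment k) (jmoment k.+1 x).
Proof.
pose f y z := z ^+ k * jweight alpha beta y z.
have d1E y z : partial1of2 f y z = z ^+ k.+1 * jweight alpha beta y z.
  by rewrite partial1of2E; have [_ ->] := is_derive_jweight k z y.
(* Dominating function: for [|y - x| < 1] and [|z| <= 1] one has [y z <= |x| + 1]. *)
pose D z := expR (`|x| + 1) * w z.
have Ix : `]x - 1, x + 1[%classic x by rewrite /= in_itv/=; lra.
have fi y : `]x - 1, x + 1[%classic y -> mu.-integrable `[-1, 1] (EFin \o f y).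
  by move=> _; exact: integrable_jmoment.
have fd y z : `]x - 1, x + 1[%classic y -> `[-1, 1]%classic z ->
    derivable (f ^~ z) y 1.
  by move=> _ _; have [] := is_derive_jweight k z y.
have D0 z : 0 <= D z by rewrite mulr_ge0// expR_ge0.
have Di : mu.-integrable `[-1, 1] (EFin \o D).
  by apply: integrable_continuous_jacobi => z; exact: cvg_cst.
have Db y z : `]x - 1, x + 1[%classic y -> `[-1, 1]%classic z ->
    `|partial1of2 f y z| <= D z.
  rewrite /= !in_itv/= => /andP[y1 y2] /andP[z1 z2].
  have zn : `|z| <= 1 by rewrite ler_norml z1 z2.
  rewrite d1E jweightE /D mulrA normrM (ger0_norm (w_ge0 z)) ler_wpM2r//.
  rewrite normrM (ger0_norm (expR_ge0 _)) -[leRHS]mul1r.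
  rewrite ler_pM ?expR_ge0// ?normrX ?exprn_ile1//.
  rewrite ler_expR (le_trans (ler_norm _))// normrM -[leRHS]mulr1 ler_pM//.
  rewrite ler_norml; have := ler_norm x; have := ler_norm (- x).
  by rewrite normrN; lra.
have -> : jmoment k = (fun y => \int[mu]_(z in `[-1, 1]) f y z) by [].
apply: DeriveDef.
  exact: (@derivable_under_integral R _ _ mu f `[-1, 1]%classic
    (measurable_itv _) x _ _ Ix fi fd D D0 Di Db).
rewrite -derive1E (@differentiation_under_integral R _ _ mu f `[-1, 1]%classic
  (measurable_itv _) x _ _ Ix fi fd D D0 Di Db).
by apply: eq_Rintegral => z _; rewrite d1E.
Qed.

End JacobiMoments.

(** * Integration by parts and the moment recurrence *)

Section Recursion.
Local Open Scope classical_set_scope.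
Local Open Scope ring_scope.
Variables (R : realType).
Local Notation mu := (@lebesgue_measure R).
Implicit Types (p s x z : R) (k : nat).

(** At the endpoint the base vanishes, which is outside the scope of [continuous_powR_affine]; the
    boundary term of the integration by parts needs this limit. *)
Lemma cvg_powR_affine_right p : 0 < p ->
  (1 + (-1) * z) `^ p @[z --> (1 : R)^'-] --> (0 : R).
Proof.
move=> p0; apply/cvgrPdist_lt => /= e e0.
have [d /= d0 Hd] := powR_cvg0 p0 (nbhsx_ballx (0 : R) _ e0).
exists d => //= z zd z1; rewrite sub0r normrN.
have := Hd (1 + (-1) * z); rewrite /ball/= !sub0r !normrN; apply.
  by rewrite mulN1r.
by rewrite mulN1r subr_gt0.
Qed.

Lemma cvg_powR_affine_left p : 0 < p ->
  (1 + 1 * z) `^ p @[z --> (-1 : R)^'+] --> (0 : R).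
Proof.
move=> p0; apply/cvgrPdist_lt => /= e e0.
have [d /= d0 Hd] := powR_cvg0 p0 (nbhsx_ballx (0 : R) _ e0).
exists d => //= z zd z1; rewrite sub0r normrN.
have := Hd (1 + 1 * z); rewrite /ball/= !sub0r !normrN; apply.
  by rewrite -normrN (_ : - _ = -1 - z)//; ring.
by rewrite mul1r; lra.
Qed.

Variables (alpha beta : R).
Hypotheses (alpha1 : -1 < alpha) (beta1 : -1 < beta).

Local Notation m := (jmoment alpha beta).
Local Notation J := (jweight alpha beta).

(** [F] vanishes at both endpoints because its exponents [alpha + 1] and [beta + 1] are positive,
    and its derivative is the polynomial [q] times the weight. *)
Lemma jmoment_rec x k :
  k%:R * m k.-1 x - (k%:R + 2 + (alpha + beta)) * m k.+1 x
  + x * (m k x - m k.+2 x) - (alpha - beta) * m k x = 0.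
Proof.
have a0 : 0 < alpha + 1 by rewrite -ltrBlDr sub0r.
have b0 : 0 < beta + 1 by rewrite -ltrBlDr sub0r.
pose e z := z ^+ k * expR (x * z).
pose F z := e z * (1 + (-1) * z) `^ (alpha + 1) * (1 + 1 * z) `^ (beta + 1).
pose de z := k%:R * z ^+ k.-1 * expR (x * z) + x * e z.
pose q z := k%:R * z ^+ k.-1 - (k%:R + 2 + (alpha + beta)) * z ^+ k.+1
  + x * (z ^+ k - z ^+ k.+2) - (alpha - beta) * z ^+ k.
have eD z : is_derive z 1 e (de z).
  have gD : is_derive z 1 (fun y : R => x *: y) x.
    by have /is_derive_eq := is_deriveZ x (is_derive_id z 1); apply; exact: mulr1.
  have xD := @is_derive1_comp _ expR (fun y => x *: y) z _ _ (is_derive_expR _) gD.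
  have XE : (fun y : R => y ^+ k) = id ^+ k.
    by apply/funext => y; elim: (k) => // j IH; rewrite !exprS IH.
  have kD : is_derive z 1 (fun y : R => y ^+ k) (k%:R * z ^+ k.-1).
    rewrite XE; have /is_derive_eq := is_deriveX k (is_derive_id z 1); apply.
    exact: mulr1.
  have /is_derive_eq := is_deriveM kD xD; apply.
  rewrite /de /e -![_ *: _]/(_ * _) /=; ring.
have ec z : {for z, continuous e}.
  by have [D _] := eD z; exact/differentiable_continuous/derivable1_diffP.
have FD z : z \in `]-1, 1[ -> is_derive z 1 F (q z * J x z).
  rewrite in_itv/= => /andP[z1 z2].
  have A0 : 0 < 1 + (-1) * z by lra.
  have B0 : 0 < 1 + 1 * z by lra.
  have /is_derive_eq := is_deriveM (is_deriveM (eD z)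
    (is_derive_powR_affine (alpha + 1) A0)) (is_derive_powR_affine (beta + 1) B0).
  apply; have mulE (f g : R -> R) : (f * g) z = f z * g z by [].
  rewrite mulE -![_ *: _]/(_ * _) /= !addrK.
  (* Splitting one factor off each power exposes the weight as a common factor and leaves a
     polynomial identity. *)
  have -> : (1 + -1 * z) `^ (alpha + 1) = (1 - z) * (1 - z) `^ alpha.
    by rewrite -(mulr_powRB1 (ltW A0) a0) addrK mulN1r.
  have -> : (1 + 1 * z) `^ (beta + 1) = (1 + z) * (1 + z) `^ beta.
    by rewrite -(mulr_powRB1 (ltW B0) b0) addrK mul1r.
  rewrite mulN1r mul1r /jweight /q /de /e.
  move: (expR _) (_ `^ alpha) (_ `^ beta) => E A B.
  by case: (k) => [|j] /=; rewrite ?exprS; ring.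
have qc : continuous q.
  have cX (u : R) j : continuous (fun z : R => u * z ^+ j).
    by move=> z; apply: cvgM; [exact: cvg_cst | exact: exprn_continuous].
  move=> z; apply: cvgB; last exact: cX.
  apply: cvgD; first by apply: cvgB; exact: cX.
  apply: cvgM; first exact: cvg_cst.
  by apply: cvgB; exact: exprn_continuous.
have qJi : mu.-integrable `[-1, 1] (EFin \o (fun z => q z * J x z)).
  exact: integrable_jweight.
have F1 : F 1 = 0.
  have E1 : 1 + -1 * 1 = 0 :> R by ring.
  by rewrite /F E1 powR0 ?mulr0 ?mul0r// gt_eqF.
have FN1 : F (-1) = 0.
  have E1 : 1 + 1 * -1 = 0 :> R by ring.
  by rewrite /F E1 powR0 ?mulr0// gt_eqF.
have := @integrable_FTC2 R (fun z => q z * J x z) F (-1) 1 _ qJi.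
rewrite F1 FN1 subrr => Int0.
have {}Int0 : \int[mu]_(z in `[-1, 1]) (q z * J x z) = 0.
  apply: Int0.
  - lra.
  - move=> z; rewrite in_itv/= => /andP[z1 z2].
    have A0 : 0 < 1 + (-1) * z by lra.
    have B0 : 0 < 1 + 1 * z by lra.
    have -> : (fun z => q z * J x z) = (fun z => q z * expR (x * z) *
       (1 + (-1) * z) `^ alpha * (1 + 1 * z) `^ beta).
      by apply/funext => y; rewrite /jweight mulN1r mul1r !mulrA.
    apply: cvgM; [apply: cvgM; [apply: cvgM|]|].
    + exact: qc.
    + apply: (@continuous_comp _ _ _ (fun z => x * z) expR).
        by apply: cvgM; [exact: cvg_cst | exact: cvg_id].
      exact: continuous_expR.
    + exact: continuous_powR_affine.
    + exact: continuous_powR_affine.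
  - split.
    + by move=> z /FD [].
    + rewrite FN1 -[X in _ --> X](mulr0 (e (-1) * (1 + -1 * -1) `^ (alpha + 1))).
      apply: cvgM; last by apply: cvg_powR_affine_left; lra.
      apply: cvg_at_right_filter; apply: cvgM; first exact: ec.
      by apply: continuous_powR_affine; lra.
    + have E1 : 0 = e 1 * 0 * (1 + 1 * 1) `^ (beta + 1) by rewrite mulr0 mul0r.
      rewrite F1 [X in _ --> X]E1.
      apply: cvgM; last first.
        by apply: cvg_at_left_filter; apply: continuous_powR_affine; lra.
      apply: cvgM; first by apply: cvg_at_left_filter; exact: ec.
      by apply: cvg_powR_affine_right; lra.
  - by move=> z /FD [_ <-]; rewrite derive1E.
(* Coefficients and exponents of the five monomials of [q], in matching order. *)
pose c : seq R := [:: k%:R; - (k%:R + 2 + (alpha + beta)); x; - x; - (alpha - beta)].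
pose d : seq nat := [:: k.-1; k.+1; k; k.+2; k].
have := @Rintegral_linear _ _ _ mu 'I_5 (index_enum _) (fun i => c`_i)
  (fun i z => z ^+ nth 0%N d i * J x z) `[-1, 1]%classic (measurable_itv _)
  (fun i => integrable_jmoment alpha1 beta1 _ _).
rewrite (_ : Rintegral _ _ _ = \int[mu]_(z in `[-1, 1]) (q z * J x z)); last first.
  apply: eq_Rintegral => z _; rewrite !big_ord_recl big_ord0 /= /q; ring.
rewrite Int0 !big_ord_recl big_ord0 /= -!/(m _ x) => E.
rewrite [RHS]E; ring.
Qed.

End Recursion.

(** * Positivity and Heine's formula *)

Lemma finite_set_root (F : idomainType) (p : {poly F}) :
  p != 0 -> finite_set [set z | root p z]%classic.
Proof.
move=> p0; apply: contrapT => /(infinite_set_fset (size p))[B Bp].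
rewrite leqNgt => /negP; apply; apply: max_poly_roots => //.
  by apply/allP => z zB; exact: Bp.
exact: finmap.fset_uniq.
Qed.

Section HeinePositivity.
Local Open Scope classical_set_scope.
Local Open Scope ring_scope.
Variables (R : realType).
Local Notation mu := (@lebesgue_measure R).

Variables (alpha beta : R).
Hypotheses (alpha1 : -1 < alpha) (beta1 : -1 < beta).

Local Notation m := (jmoment alpha beta).
Local Notation J := (jweight alpha beta).

(** A nonnegative integrand with zero integral vanishes almost everywhere. The weight is positive
    inside the interval, so for nonzero [p] the interval would be covered, up to a null set, by
    finitely many roots. *)
Lemma jacobi_form_eq0 (p : {poly R}) (x : R) :
  \int[mu]_(z in `[-1, 1]) (p.[z] ^+ 2 * J x z) = 0 -> p = 0.
Proof.
move=> int0; apply/eqP; apply: contraT => p0.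
pose f z := p.[z] ^+ 2 * J x z.
have J0 z : 0 <= J x z by rewrite !mulr_ge0 ?expR_ge0 ?powR_ge0.
have f0 z : 0 <= f z by rewrite mulr_ge0// sqr_ge0.
have fi : mu.-integrable `[-1, 1] (EFin \o f).
  apply: integrable_jweight => // z; apply: cvgM; exact: continuous_horner.
have [fm _] := integrableP _ _ _ fi.
have : (\int[mu]_(z in `[(-1)%R, 1%R]) `|(EFin \o f) z| = 0)%E.
  under eq_integral do rewrite /= ger0_norm//.
  rewrite -[LHS]fineK; last exact: integrable_fin_num fi.
  by congr EFin.
move/(ae_eq_integral_abs mu (measurable_itv _) fm) => ae0.
have root0 : mu.-negligible [set z | root p z].
  have cr : countable [set z | root p z].
    exact/finite_set_countable/finite_set_root.
  exists [set z | root p z]; split => //.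
    by apply: countable_measurable => // t; exact: measurable_set1.
  exact: countable_lebesgue_measure0.
have neg : mu.-negligible `]-1, 1[.
  apply: negligibleS (negligibleU ae0 root0) => z z11.
  have [rz|nrz] := boolP (root p z); [by right | left => /= fz].
  move/negP: nrz; apply; move: z11; rewrite /= in_itv/= => /andP[z1 z2].
  have /fz [] : `[-1, 1]%classic z by rewrite /= in_itv/= !ltW.
  move/eqP; rewrite mulf_eq0 => /orP[|].
    by rewrite sqrf_eq0 rootE.
  rewrite gt_eqF// !mulr_gt0 ?expR_gt0// powR_gt0; lra.
have : mu `]-1, 1[%classic = 0%E by exact: measure_negligible.
rewrite lebesgue_measure_itv /= lte_fin ifT; last by lra.
by move=> /eqP; rewrite -EFinD eqe => /eqP; lra.
Qed.

(** A null vector [v] of the Hankel matrix is the coefficient vector of a polynomial whose square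
    has integral [v G v^T = 0]. *)
Lemma hankel_jmoment_unit (n : nat) (x : R) : hankel n (m^~ x) 0 \in unitmx.
Proof.
rewrite unitmxE unitfE; apply/negP => /det0P[v v0 vG].
have hv z : (rVpoly v).[z] = \sum_(i < n) v 0 i * z ^+ i.
  by rewrite horner_poly; apply: eq_bigr => i _; rewrite valK.
suff /(congr1 (@poly_rV R n)) : rVpoly v = 0.
  by rewrite rVpolyK linear0 => E; move: v0; rewrite E eqxx.
apply: (@jacobi_form_eq0 _ x).
have := @Rintegral_linear _ _ _ mu ('I_n * 'I_n)%type (index_enum _)
  (fun ij => v 0 ij.1 * v 0 ij.2) (fun ij z => z ^+ (ij.1 + ij.2) * J x z)
  `[-1, 1]%classic (measurable_itv _)
  (fun i => integrable_jmoment alpha1 beta1 _ _).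
rewrite (_ : Rintegral _ _ _ =
    \int[mu]_(z in `[-1, 1]) ((rVpoly v).[z] ^+ 2 * J x z)); last first.
  apply: eq_Rintegral => z _; rewrite hv expr2 big_distrlr/= mulr_suml.
  under [in RHS]eq_bigr do rewrite mulr_suml.
  rewrite pair_bigA/=; apply: eq_bigr => ij _; rewrite exprD; ring.
move=> ->; rewrite -(pair_bigA _ (fun i j => v 0 i * v 0 j * m (i + j) x))/=.
rewrite exchange_big/= big1// => j _.
have := congr1 (fun A : 'rV_n => A 0 j) vG; rewrite !mxE => E.
transitivity (v 0 j * \sum_i v 0 i * m (i + j) x).
  by rewrite mulr_sumr; apply: eq_bigr => i _; ring.
rewrite (_ : \sum_i _ = 0) ?mulr0// -[RHS]E; apply: eq_bigr => i _.
by rewrite mxE addn0.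
Qed.

(** The cube integral is iterated, so linearity pulls out the product one variable at a time. *)
Lemma cube_int_sum_prod (I : Type) (r : seq I) (n : nat) (c : I -> R)
    (f : I -> nat -> R -> R) :
  (forall i k, mu.-integrable `[-1, 1] (EFin \o f i k)) ->
  cube_int n (fun z => \sum_(i <- r) c i * \prod_(k < n) f i k z`_k) =
  \sum_(i <- r) c i * \prod_(k < n) \int[mu]_(z in `[-1, 1]) f i k z.
Proof.
elim: n c f => [|n IH] c f fi.
  by apply: eq_bigr => i _; rewrite !big_ord0.
transitivity (\int[mu]_(t in `[-1, 1])
  \sum_(i <- r) c i * (\prod_(k < n) \int[mu]_(z in `[-1, 1]) f i k.+1 z) * f i 0 t).
  apply: eq_Rintegral => t _ /=.
  transitivity (cube_int n (fun s => \sum_(i <- r) (c i * f i 0%N t) *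
      \prod_(k < n) f i k.+1 s`_k)).
    congr cube_int; apply/funext => s; apply: eq_bigr => i _.
    by rewrite big_ord_recl/= mulrA.
  rewrite (IH (fun i => c i * f i 0%N t) (fun i k => f i k.+1))//.
  by apply: eq_bigr => i _; rewrite mulrAC.
rewrite (@Rintegral_linear _ _ _ mu I r
  (fun i => c i * (\prod_(k < n) \int[mu]_(z in `[-1, 1]) f i k.+1 z))
  (fun i => f i 0%N))//.
by apply: eq_bigr => i _; rewrite big_ord_recl /= -mulrA (mulrC (\prod_(_ < _) _)).
Qed.

(** Product of two Leibniz expansions of the Vandermonde determinant. *)
Lemma vandermonde_sqr (n : nat) (z : seq R) :
  vandermonde n z ^+ 2 = \sum_(st : 'S_n * 'S_n)
    ((-1) ^+ st.1 * (-1) ^+ st.2) * \prod_(k < n) z`_k ^+ (st.1 k + st.2 k).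
Proof.
have -> : vandermonde n z = \det (Vandermonde n (\row_(i < n) z`_i))^T.
  rewrite det_tr det_Vandermonde; apply: eq_bigr => i _; apply: eq_bigr => j _.
  by rewrite !mxE.
rewrite expr2 /determinant big_distrlr/= pair_bigA/=; apply: eq_bigr => st _.
rewrite mulrACA -big_split/=; congr (_ * _); apply: eq_bigr => k _.
by rewrite !mxE exprD.
Qed.

(** Heine's formula: after integrating the double Leibniz expansion, each choice of the first
    permutation contributes the same Hankel determinant, whence the factor [n!]. *)
Lemma tau_hankel (n : nat) (c x : R) :
  tau n alpha beta c x = c * n`!%:R * \det (hankel n (m^~ x) 0).
Proof.
rewrite /tau -mulrA; congr (_ * _).
(* Extends the exponents from ['I_n] to all naturals, with default 0, to fit the shape of
   [cube_int_sum_prod]. *)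
pose e (st : 'S_n * 'S_n) (k : nat) : nat :=
  oapp (fun i : 'I_n => (st.1 i + st.2 i)%N) 0%N (insub k).
transitivity (cube_int n (fun z => \sum_(st : 'S_n * 'S_n)
   ((-1) ^+ st.1 * (-1) ^+ st.2) *
   \prod_(k < n) (z`_k ^+ e st k * J x z`_k))).
  congr cube_int; apply/funext => z; rewrite vandermonde_sqr mulr_suml.
  apply: eq_bigr => st _; rewrite -[LHS]mulrA -big_split/=; congr (_ * _).
  by apply: eq_bigr => k _; rewrite /e valK.
rewrite (@cube_int_sum_prod _ _ n _ (fun st k z => z ^+ e st k * J x z)); last first.
  by move=> st k; exact: integrable_jmoment.
transitivity (\sum_(s : 'S_n) \det (hankel n (m^~ x) 0)); last first.
  by rewrite sumr_const card_Sn mulr_natl.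
rewrite -(pair_bigA _ (fun s t : 'S_n => ((-1) ^+ s * (-1) ^+ t) *
  \prod_(k < n) \int[mu]_(z in `[-1, 1]) (z ^+ e (s, t) k * J x z)))/=.
apply: eq_bigr => s _.
(* For fixed [s] the sum over [t] is the determinant with rows permuted by [s], and the two signs of
   [s] cancel. *)
transitivity ((-1) ^+ s * \det (row_perm s (hankel n (m^~ x) 0))); last first.
  by rewrite row_permE det_mulmx det_perm signrMK.
rewrite mulr_sumr; apply: eq_bigr => t _; rewrite -mulrA; congr (_ * (_ * _)).
by apply: eq_bigr => k _; rewrite !mxE /e valK addn0.
Qed.

End HeinePositivity.

Theorem theorem3p1 (R : realType) (n : nat) (alpha beta c : R) :
  (1 <= n)%N -> -1 < alpha -> -1 < beta -> c != 0 ->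
  let a := alpha + beta in
  let b := alpha - beta in
  let H := Hfun n alpha beta c in
  (forall x : R, derivable (tau n alpha beta c) x 1) /\
  (forall x : R, [/\ derivable H x 1, derivable (derive1 H) x 1 & derivable (derive1n 2 H) x 1]) /\
  (forall x : R,
     x ^+ 2 * derive1n 3 H x + x * derive1n 2 H x + 6 * x * (derive1 H x) ^+ 2
     - (4 * H x + 4 * x ^+ 2 - 4 * b * x + (2 * n%:R + a) ^+ 2) * derive1 H x
     + (4 * x - 2 * b) * H x + 2 * n%:R * (n%:R + a) * x
     - b * n%:R * (2 * n%:R + a) = 0) /\
  H 0 = 0 /\
  derive1 H 0 = - n%:R * b / (a + 2 * n%:R).
Proof.
move=> n1 a1 b1 c0 a b H.
have mD := is_derive_jmoment a1 b1.
have Gu := hankel_jmoment_unit a1 b1 n.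
have mrec := jmoment_rec a1 b1.
have C0 : c * n`!%:R != 0 by rewrite mulf_neq0// pnatr_eq0 -lt0n fact_gt0.
have tauE : tau n alpha beta c =
    (fun x => c * n`!%:R * \det (hankel n ((jmoment alpha beta)^~ x) 0)).
  by apply/funext => x; exact: tau_hankel.
have D := scaled_det_derivable mD Gu C0.
have E := scaled_det_ode mD Gu mrec C0.
have [H0 H'0] := scaled_det_init mD Gu mrec C0.
rewrite /H /Hfun tauE; split=> [x|]; first by have [Dx _ _ _] := D x; exact: Dx.
split=> [x|].
  by have [_ D0 D1 D2] := D x; split; [exact: D0 | exact: D1 | exact: D2].
split; first exact: E.
split; first exact: H0.
(* Positive because [n >= 1] and [a > -2]; this allows the division in the value of [H'(0)]. *)
have s0 : 0 < 2 * n%:R + a.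
  have : 1 <= n%:R :> R by rewrite ler1n.
  by rewrite /a; lra.
rewrite (addrC a) -H'0 mulrAC mulfV ?mul1r//.
by rewrite gt_eqF.
Qed.
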